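(* Let $K$ be a field, $S=K[x_1,\ldots,x_n]$, and let $I\subset S$ be a monomial ideal with $\dim S/I=0$. Let $L(I)\subset S^\wp$ be the ideal generated by the monomials $x_{1,a_1+1}\cdots x_{n,a_n+1}$ with $x_1^{a_1}\cdots x_n^{a_n}\in\operatorname{Mon}(S\setminus I)$. For every $i\geq 1$, $$\beta_i(S^\wp/L(I))=\sum_{j\geq 0}h_j\binom{j}{i-1},$$ where $h_j=h_j(S/I)$ is the $j$-th component of the $h$-vector of $S/I$. In particular, $\operatorname{proj\,dim} S^\wp/L(I)=\max\{\deg u : u\in\operatorname{Mon}(S\setminus I)\}+1$.
   Context: $\operatorname{Mon}(S\setminus I)$ is the (finite) set of monomials of $S$ not belonging to $I$. For $i=1,\ldots,n$ let $b_i\ge 1$ be the smallest integer with $x_i^{b_i}\in I$ (it exists since $\dim S/I=0$). $S^\wp$ is the polynomial ring over $K$ in the variables $x_{i,j}$, $1\le i\le n$, $1\le j\le b_i$. $\beta_i(M)$ denotes the $i$-th (total) Betti number of a finitely generated graded $S^\wp$-module $M$, i.e. the rank of the $i$-th module in its minimal graded free resolution over $S^\wp$. Since $\dim S/I=0$, $h_j(S/I)=\dim_K(S/I)_j$, i.e. the number of monomials of degree $j$ in $\operatorname{Mon}(S\setminus I)$. *)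

(* Defs.v *)
From HB Require Import structures.
From mathcomp Require Import all_boot all_order all_algebra.
From mathcomp Require Import boolp classical_sets fsbigop.
From mathcomp Require Import mpoly.

Set Implicit Arguments.
Unset Strict Implicit.
Unset Printing Implicit Defensive.

Import GRing.Theory.
Local Open Scope ring_scope.
Local Open Scope classical_set_scope.
Local Open Scope quotient_scope.

(* Both return the junk value 0 when there is no least (greatest) element. *)
Definition nat_min (A : set nat) : nat :=
  xget 0%N [set d | A d /\ forall e, A e -> (d <= e)%N].
Definition nat_max (A : set nat) : nat :=
  xget 0%N [set d | A d /\ forall e, A e -> (e <= d)%N].

Section Ideals.
Variable R : comNzRingType.

Definition in_gen (G : set R) (x : R) : Prop :=
  exists2 s : seq (R * R), (forall c, c \in s -> G c.2) &
    x = \sum_(c <- s) c.1 * c.2.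

Definition ideal_gen (G : set R) : {pred R} := fun x => `[< in_gen G x >].

Lemma ideal_genP (G : set R) x : reflect (in_gen G x) (x \in ideal_gen G).
Proof. exact: asboolP. Qed.

Lemma ideal_gen_mull (G : set R) a x : x \in ideal_gen G -> a * x \in ideal_gen G.
Proof.
move=> /ideal_genP[s sG ->]; apply/ideal_genP.
exists [seq (a * c.1, c.2) | c <- s].
  by move=> c /mapP[d ds ->] /=; exact: (sG d ds).
by rewrite big_map mulr_sumr; apply: eq_bigr => c _; rewrite mulrA.
Qed.

Lemma ideal_gen_zmod_closed (G : set R) : zmod_closed (ideal_gen G).
Proof.
have addG x y : x \in ideal_gen G -> y \in ideal_gen G -> x + y \in ideal_gen G.
  move=> /ideal_genP[s sG ->] /ideal_genP[t tG ->]; apply/ideal_genP.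
  exists (s ++ t); last by rewrite big_cat.
  by move=> c; rewrite mem_cat => /orP[/sG|/tG].
split=> [|x y xG yG]; first by apply/ideal_genP; exists [::]; rewrite ?big_nil.
by apply: addG => //; rewrite -mulN1r; exact: ideal_gen_mull.
Qed.

HB.instance Definition _ (G : set R) :=
  GRing.isZmodClosed.Build R (ideal_gen G) (ideal_gen_zmod_closed G).

(* The quotient R / (G) as an R-module.  When G is itself an ideal, (G) = G. *)
Definition qmod (G : set R) : Type :=
  Quotient.quot (ideal_gen G : GRing.ZmodClosed.type R).

HB.instance Definition _ (G : set R) := GRing.Zmodule.on (qmod G).

Definition qpi (G : set R) (x : R) : qmod G :=
  \pi_(Quotient.quot (ideal_gen G : GRing.ZmodClosed.type R)) x.

Definition qscale (G : set R) (a : R) (x : qmod G) : qmod G := qpi G (a * repr x).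

Lemma qpiP (G : set R) x y : qpi G x = qpi G y <-> x - y \in ideal_gen G.
Proof.
rewrite (Quotient.idealrBE (ideal_gen G : GRing.ZmodClosed.type R)).
exact: (rwP eqP).
Qed.

Lemma qpi_repr (G : set R) (x : qmod G) : qpi G (repr x) = x.
Proof. exact: reprK. Qed.

Lemma qpiD (G : set R) x y : qpi G (x + y) = qpi G x + qpi G y.
Proof. exact: (raddfD (\pi_(Quotient.quot (ideal_gen G : GRing.ZmodClosed.type R)))). Qed.

Lemma qscale_pi (G : set R) a x : qscale a (qpi G x) = qpi G (a * x).
Proof. by apply/qpiP; rewrite -mulrBr ideal_gen_mull//; apply/qpiP/qpi_repr. Qed.

Lemma qscaleA (G : set R) a b (x : qmod G) :
  qscale a (qscale b x) = qscale (a * b) x.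
Proof. by rewrite -(qpi_repr x) !qscale_pi mulrA. Qed.

Lemma qscale1 (G : set R) : left_id 1 (@qscale G).
Proof. by move=> x; rewrite -(qpi_repr x) qscale_pi mul1r. Qed.

Lemma qscaleDr (G : set R) : right_distributive (@qscale G) +%R.
Proof. by move=> a x y; rewrite -(qpi_repr x) -(qpi_repr y) -qpiD !qscale_pi mulrDr qpiD. Qed.

Lemma qscaleDl (G : set R) (x : qmod G) :
  {morph (fun a => qscale a x) : a b / a + b}.
Proof. by move=> a b; rewrite -(qpi_repr x) !qscale_pi mulrDl qpiD. Qed.

HB.instance Definition _ (G : set R) :=
  GRing.Zmodule_isLmodule.Build R (qmod G)
    (@qscaleA G) (@qscale1 G) (@qscaleDr G) (@qscaleDl G).

(* The prime ideals of R / J correspond to the primes of R containing J. *)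
Definition prime_chain (J : {pred R}) (l : nat) : Prop :=
  exists P : nat -> {pred R},
    (forall i, (i <= l)%N ->
       [/\ idealr_closed (P i), prime_idealr_closed (P i) & {subset J <= P i}]) /\
    (forall i, (i < l)%N ->
       {subset P i <= P i.+1} /\ exists2 x, x \in P i.+1 & x \notin P i).

Definition krull_dim_quot (J : {pred R}) (d : nat) : Prop :=
  prime_chain J d /\ forall l, prime_chain J l -> (l <= d)%N.

End Ideals.

Section ProjectiveDimension.
Variable R : comNzRingType.

Definition projective (P : lmodType R) : Prop :=
  forall (A B : lmodType R) (g : {linear A -> B}) (f : {linear P -> B}),
    (forall y, exists x, g x = y) ->
    exists h : {linear P -> A}, forall x, g (h x) = f x.

Definition has_proj_resolution (M : lmodType R) (l : nat) : Prop :=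
  exists (P : nat -> lmodType R) (d : forall i, {linear P i.+1 -> P i})
         (eps : {linear P 0%N -> M}),
    [/\ forall i, projective (P i),
        forall y, exists x, eps x = y,
        forall x, eps x = 0 <-> exists z, d 0%N z = x,
        forall i x, d i x = 0 <-> exists z, d i.+1 z = x &
        forall i, (l < i)%N -> forall x : P i, x = 0].

Definition projdim (M : lmodType R) : nat :=
  nat_min [set l | has_proj_resolution M l].

End ProjectiveDimension.

Section Graded.
Variables (K : fieldType) (n : nat).
Local Notation R := {mpoly K[n]}.

(* The standard grading of R / (G), for G consisting of homogeneous elements. *)
Definition qgrading (G : set R) (d : int) : set (qmod G) :=
  [set x | exists k : nat, d = k%:Z /\
     exists2 p : R, p \is k.-homog & x = qpi G p].

Definition irrelevant_ideal : {pred R} :=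
  ideal_gen [set p : R | exists j : 'I_n, p = 'X_j].

(* M is an R-module whose homogeneous component of degree d is gr d.  The
   resolution is ... -> F_1 -> F_0 -> M -> 0 with F_i the free module of row
   vectors of length rk i; its k-th basis vector has degree sh i k, i.e.
   F_i = \bigoplus_k R(- sh i k).  The map F_(i+1) -> F_i is v |-> v *m D i, and
   F_0 -> M sends the k-th basis vector to g k. *)
Definition minimal_free_resolution (M : lmodType R) (gr : int -> set M)
    (rk : nat -> nat) : Prop :=
  exists (sh : forall i, 'I_(rk i) -> int)
         (D : forall i, 'M[R]_(rk i.+1, rk i)) (g : 'I_(rk 0%N) -> M),
    let eps (v : 'rV[R]_(rk 0%N)) := \sum_k v 0 k *: g k in
    [/\ (* exactness *)
        [/\ forall y, exists v, eps v = y,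
            forall v, eps v = 0 <-> exists w, w *m D 0%N = v &
            forall i (v : 'rV[R]_(rk i.+1)), v *m D i = 0 <-> exists w, w *m D i.+1 = v],
        (* the maps are homogeneous of degree 0 *)
        (forall k, gr (sh 0%N k) (g k)) /\
        (forall i k l m, m \in msupp (D i k l) ->
           (mdeg m)%:Z + sh i l = sh i.+1 k) &
        (* minimality: the image of F_(i+1) lies in (X_1, ..., X_n) F_i *)
        forall i k l, D i k l \in irrelevant_ideal].

(* The ranks of a minimal free resolution are unique, and one exists when M is
   finitely generated. *)
Definition betti (M : lmodType R) (gr : int -> set M) (i : nat) : nat :=
  xget 0%N [set r | exists2 rk, minimal_free_resolution gr rk & r = rk i].

Definition is_Kbasis (M : lmodType R) (U : set M) (d : nat) (e : 'I_d -> M) :=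
  [/\ forall k, U (e k),
      forall c : 'I_d -> K, \sum_k (c k)%:MP *: e k = 0 -> forall k, c k = 0 &
      forall x, U x -> exists c : 'I_d -> K, x = \sum_k (c k)%:MP *: e k].

Definition Kdim (M : lmodType R) (U : set M) : nat :=
  xget 0%N [set d | exists e : 'I_d -> M, is_Kbasis U e].

End Graded.

Arguments qgrading {K n} G d.
Arguments betti {K n} M gr i.

Section MonomialIdeal.
Variables (K : fieldType) (n : nat).
Local Notation S := {mpoly K[n]}.

Definition monomial_ideal (I : {pred S}) : Prop :=
  exists A : set 'X_{1..n},
    I =i ideal_gen [set p : S | exists2 m, A m & p = 'X_[m]].

Variable I : {pred S}.

Definition Mon : set 'X_{1..n} := [set u | ('X_[u] : S) \notin I].

(* j-th component of the h-vector of S/I when dim S/I = 0 *)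
Definition hcomp (j : nat) : nat := Kdim (qgrading [set` I] j%:Z).

Definition bexp (i : 'I_n) : nat :=
  nat_min [set k | (1 <= k)%N /\ ('X_i : S) ^+ k \in I].

(* The index of x_{i,j} is the pair (i, j - 1). *)
Definition wpvar : finType := {i : 'I_n & 'I_(bexp i)}.

Definition xvar (i : 'I_n) (j : 'I_(bexp i)) : {mpoly K[#|wpvar|]} :=
  'X_(enum_rank (Tagged (fun i => 'I_(bexp i)) j : wpvar)).

(* Every u in Mon satisfies u i < bexp i, so a below is determined by u. *)
Definition Lgens : set {mpoly K[#|wpvar|]} :=
  [set p | exists2 u, Mon u &
     exists2 a : forall i, 'I_(bexp i), (forall i, a i = u i :> nat) &
       p = \prod_(i < n) xvar (a i)].

End MonomialIdeal.

Arguments Mon {K n} I.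
Arguments Lgens {K n} I.

(* Main.v *)
Require Import Defs.
From HB Require Import structures.
From mathcomp Require Import all_boot all_order all_algebra.
From mathcomp Require Import boolp classical_sets fsbigop.
From mathcomp Require Import mpoly.
Local Open Scope classical_set_scope.

(* Order the monomials u of Mon(S \ I) by degree.  The generator of L(I) attached
   to u is u with each x_i^(u_i) replaced by x_(i, u_i + 1), and the colon ideal of
   the earlier generators by it is generated by the deg u variables x_(i, k) with
   k <= u_i: L(I) has linear quotients.  Adding one generator at a time, the
   mapping cone of the Koszul complex of these variables adds C(deg u, i - 1) to
   the i-th Betti number; it stays minimal because all syzygies are linear.  The
   Koszul complex itself is obtained from the same mapping cone, the colon ideal of
   (t_1, ..., t_d) by t_(d+1) being (t_1, ..., t_d).  Finally, modulo the irrelevant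
   ideal, any comparison of a minimal resolution with a projective one is split,
   which gives the uniqueness of the ranks and the projective dimension. *)

(** * Lifting maps out of projective modules *)

Section ImageModule.

Set Implicit Arguments.
Unset Strict Implicit.
Import GRing.Theory.
Local Open Scope ring_scope.

Variables (R : comNzRingType) (A B : lmodType R) (g : {linear A -> B}).

Definition im_pred : {pred B} := fun y => `[< exists x, g x = y >].

Lemma im_predP y : reflect (exists x, g x = y) (y \in im_pred).
Proof. exact: asboolP. Qed.

Lemma im_pred_submod_closed : submod_closed im_pred.
Proof.
split; first by apply/im_predP; exists 0; rewrite linear0.
move=> a _ _ /im_predP[x <-] /im_predP[y <-]; apply/im_predP.
by exists (a *: x + y); rewrite linearP.
Qed.

HB.instance Definition _ :=
  GRing.isSubmodClosed.Build R B im_pred im_pred_submod_closed.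

Record image_mod := ImageMod { im_val :> B; im_valP : im_val \in im_pred }.

HB.instance Definition _ := [isSub for im_val].
HB.instance Definition _ := [Choice of image_mod by <:].
HB.instance Definition _ := [SubChoice_isSubLmodule of image_mod by <:].

Definition coimage (x : A) : image_mod :=
  ImageMod (introT (im_predP _) (ex_intro _ x erefl)).

Lemma coimage_linear : linear coimage.
Proof. by move=> a x y; apply: val_inj; rewrite /= linearP. Qed.

HB.instance Definition _ := GRing.isLinear.Build R A image_mod *:%R coimage
  coimage_linear.

Section Corestriction.

Variables (P : lmodType R) (f : {linear P -> B}).
Hypothesis f_im : forall x, f x \in im_pred.

Definition corestr (x : P) : image_mod := ImageMod (f_im x).

Lemma corestr_linear : linear corestr.
Proof. by move=> a x y; apply: val_inj; rewrite /= linearP. Qed.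

HB.instance Definition _ := GRing.isLinear.Build R P image_mod *:%R corestr
  corestr_linear.

End Corestriction.

(** Projectivity is stated for surjections only, so [g] is replaced by its corestriction [coimage]
    onto the image, and [f] by [corestr]. *)
Lemma projective_lift (P : lmodType R) (f : {linear P -> B}) :
  projective P -> (forall x, exists y, g y = f x) ->
  exists h : {linear P -> A}, forall x, g (h x) = f x.
Proof.
move=> projP fg.
have f_im x : f x \in im_pred by apply/im_predP.
have [|h hP] := projP _ _ coimage (corestr f_im).
  by case=> y yP; have /im_predP[x xy] := yP; exists x; apply: val_inj.
by exists h => x; have /(congr1 val) := hP x.
Qed.

End ImageModule.

(** * Comparison of projective resolutions *)

Section Comparison.

Set Implicit Arguments.
Unset Strict Implicit.
Import GRing.Theory.
Local Open Scope ring_scope.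

Definition proj_resolution (R : comNzRingType) (M : lmodType R)
    (P : nat -> lmodType R) (d : forall i, {linear P i.+1 -> P i})
    (eps : {linear P 0%N -> M}) : Prop :=
  [/\ forall i, projective (P i),
      forall y, exists x, eps x = y,
      forall x, eps x = 0 <-> exists z, d 0%N z = x &
      forall i x, d i x = 0 <-> exists z, d i.+1 z = x].

(** The augmentation plays the role of the differential in degree 0, so that one inductive step
    serves all degrees. *)
Definition cycle (R : comNzRingType) (M : lmodType R)
    (P : nat -> lmodType R) (d : forall i, {linear P i.+1 -> P i})
    (eps : {linear P 0%N -> M}) (i : nat) : P i -> Prop :=
  match i with 0%N => fun x => eps x = 0 | j.+1 => fun x => d j x = 0 end.

Variables (R : comNzRingType) (M : lmodType R).

Lemma cycleP (P : nat -> lmodType R) d (eps : {linear P 0%N -> M}) i x :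
  proj_resolution d eps -> cycle d eps x <-> exists z, d i z = x.
Proof. by case: i x => [|i] x [_ _ e0 e]; [exact: e0|exact: e]. Qed.

Variables (P Q : nat -> lmodType R).
Variables (dP : forall i, {linear P i.+1 -> P i}) (epsP : {linear P 0%N -> M}).
Variables (dQ : forall i, {linear Q i.+1 -> Q i}) (epsQ : {linear Q 0%N -> M}).
Hypotheses (resP : proj_resolution dP epsP) (resQ : proj_resolution dQ epsQ).

Let cycP := @cycle R M P dP epsP.
Let cycQ := @cycle R M Q dQ epsQ.

(* A homotopy between g f and the identity in degree i, seen on cycles only:
   this is what the step to degree i + 1 needs. *)
Definition comparison_at i (f : {linear P i -> Q i}) (g : {linear Q i -> P i})
    (h : {linear P i -> P i.+1}) :=
  [/\ forall x, cycP x -> cycQ (f x), forall y, cycQ y -> cycP (g y) &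
      forall x, cycP x -> g (f x) - x = dP i (h x)].

Lemma comparison_step i f g h : @comparison_at i f g h ->
  exists f' g' h', [/\ @comparison_at i.+1 f' g' h' &
    forall x, g' (f' x) - x = dP i.+1 (h' x) + h (dP i x)].
Proof.
move=> [cf cg ch].
have bdP x : cycP (dP i x) by apply/(cycleP _ resP); exists x.
have bdQ x : cycQ (dQ i x) by apply/(cycleP _ resQ); exists x.
have [projP _ _ _] := resP; have [projQ _ _ _] := resQ.
have [f' f'P] : exists f' : {linear P i.+1 -> Q i.+1},
    forall x, dQ i (f' x) = (f \o dP i) x.
  by apply: projective_lift => // x; apply/(cycleP _ resQ)/cf.
have [g' g'P] : exists g' : {linear Q i.+1 -> P i.+1},
    forall x, dP i (g' x) = (g \o dQ i) x.
  by apply: projective_lift => // x; apply/(cycleP _ resP)/cg.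
(* The values of [k] are cycles, because the homotopy of degree [i] holds at the boundary [dP i x].
   Hence [k] lifts to the next homotopy [h']. *)
pose k : {linear P i.+1 -> P i.+1} := ((g' \o f') \- idfun \- (h \o dP i))%R.
have [h' h'P] : exists h' : {linear P i.+1 -> P i.+2},
    forall x, dP i.+1 (h' x) = k x.
  apply: projective_lift => // x; apply/(cycleP _ resP) => /=.
  rewrite !linearB/= g'P/= f'P/= -ch ?subrr//; exact: bdP.
exists f', g', h'; split; last by move=> x; rewrite h'P/= subrK.
split=> x /= xc; first by rewrite f'P/= xc linear0.
  by rewrite g'P/= xc linear0.
by rewrite h'P/= xc linear0 subr0.
Qed.

Lemma comparison_exists i : exists f g h, @comparison_at i f g h.
Proof.
elim: i => [|i [f [g [h /comparison_step[f' [g' [h' [c _]]]]]]]]; last first.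
  by exists f', g', h'.
have [projP surjP exP _] := resP; have [projQ surjQ _ _] := resQ.
have [f fP] : exists f : {linear P 0%N -> Q 0%N}, forall x, epsQ (f x) = epsP x.
  by apply: projective_lift.
have [g gP] : exists g : {linear Q 0%N -> P 0%N}, forall x, epsP (g x) = epsQ x.
  by apply: projective_lift.
pose k : {linear P 0%N -> P 0%N} := ((g \o f) \- idfun)%R.
have [h hP] : exists h : {linear P 0%N -> P 1%N}, forall x, dP 0 (h x) = k x.
  by apply: projective_lift => // x; apply/exP; rewrite linearB/= gP fP subrr.
exists f, g, h; split=> x /= xc; by [rewrite fP|rewrite gP|rewrite hP].
Qed.

Lemma comparison i : exists (f : {linear P i.+1 -> Q i.+1})
    (g : {linear Q i.+1 -> P i.+1}) (h : {linear P i.+1 -> P i.+2})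
    (h' : {linear P i -> P i.+1}),
  forall x, g (f x) - x = dP i.+1 (h x) + h' (dP i x).
Proof.
have [f [g [h /comparison_step[f' [g' [h' [_ E]]]]]]] := comparison_exists i.
by exists f', g', h', h.
Qed.

End Comparison.

(** * Free modules of row vectors *)

Section RowModules.

Set Implicit Arguments.
Unset Strict Implicit.
Import GRing.Theory.
Local Open Scope ring_scope.

Variables (R : comNzRingType) (M : lmodType R).

Definition rV_comb m (g : 'I_m -> M) (v : 'rV[R]_m) : M := \sum_k v 0 k *: g k.

Lemma rV_comb_linear m (g : 'I_m -> M) : linear (rV_comb g).
Proof.
move=> a u v; rewrite /rV_comb scaler_sumr -big_split/=; apply: eq_bigr => k _.
by rewrite !mxE scalerDl scalerA.
Qed.

HB.instance Definition _ m (g : 'I_m -> M) :=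
  GRing.isLinear.Build R 'rV[R]_m M *:%R (rV_comb g) (rV_comb_linear g).

Lemma linear_rVE m (f : {linear 'rV[R]_m -> M}) v :
  f v = rV_comb (fun k => f (delta_mx 0 k)) v.
Proof.
rewrite {1}(row_sum_delta v) linear_sum; apply: eq_bigr => k _.
by rewrite linearZ.
Qed.

End RowModules.

Lemma projective_rV (R : comNzRingType) m : projective 'rV[R]_m.
Proof.
move=> A B g f gsurj.
have /choice[a aP] : forall k, exists x, g x = f (delta_mx ord0 k).
  by move=> k; apply: gsurj.
exists (rV_comb a) => v; rewrite (linear_rVE f) /rV_comb GRing.linear_sum.
by apply: eq_bigr => k _; rewrite GRing.linearZ /= aP.
Qed.

(** * Minimal resolutions: uniqueness of the ranks, projective dimension *)

Section MinimalRanks.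

Set Implicit Arguments.
Unset Strict Implicit.
Import GRing.Theory.
Local Open Scope ring_scope.

Variables (K : fieldType) (n : nat).
Local Notation R := {mpoly K[n]}.

Lemma irrelevant_mcoeff0 (p : R) : p \in @irrelevant_ideal K n -> p@_0%MM = 0.
Proof.
move=> /ideal_genP[s sG ->]; rewrite raddf_sum big1_seq// => c /andP[_ /sG[j ->]].
by rewrite /= ?(rmorphM (mcoeff 0%MM)) /= mcoeffX mnm1_eq0 mulr0.
Qed.

Lemma mcoeff0_irrelevant (p : R) : p@_0%MM = 0 -> p \in @irrelevant_ideal K n.
Proof.
move=> p0; rewrite (mpolyE p) big_seq; apply: rpred_sum => m mp.
have [j mj] : exists j, m j != 0%N.
  apply/existsP; apply: contraTT mp; rewrite negb_exists => /forallP m0.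
  rewrite mcoeff_msupp negbK -p0; apply/eqP; congr mcoeff.
  by apply/mnmP => i; rewrite mnm0E; have /negPn/eqP := m0 i.
have Um : (U_(j) <= m)%MM.
  by apply/mnm_lepP => i; rewrite mnm1E; case: eqP => [<-|]//; rewrite lt0n.
rewrite -(submK Um) mpolyXD -mul_mpolyC mulrA; apply: ideal_gen_mull.
apply/ideal_genP; exists [:: (1, 'X_j)]; last by rewrite big_seq1 mul1r.
by move=> c; rewrite inE => /eqP->; exists j.
Qed.

Variables (M : lmodType R).

(** The matrix tensored with K, the quotient of [R] by the irrelevant ideal. *)
Definition mcoeff0_mx k l (A : 'M[R]_(k, l)) : 'M[K]_(k, l) :=
  map_mx (mcoeff 0%MM) A.

Lemma mcoeff0_mxM k l m (A : 'M[R]_(k, l)) (B : 'M[R]_(l, m)) :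
  mcoeff0_mx (A *m B) = mcoeff0_mx A *m mcoeff0_mx B.
Proof. exact: map_mxM. Qed.

Definition row_resolution (rk : nat -> nat)
    (D : forall i, 'M[R]_(rk i.+1, rk i)) (g : 'I_(rk 0%N) -> M) :=
  proj_resolution (P := fun i => 'rV[R]_(rk i) : lmodType R)
    (fun i => mulmxr (D i)) (rV_comb g).

Lemma minimal_row_resolution gr rk : @minimal_free_resolution K n M gr rk ->
  exists D g, @row_resolution rk D g /\ forall i, mcoeff0_mx (D i) = 0.
Proof.
move=> [sh [D [g [[surj e0 e] _ min]]]]; exists D, g; split; last first.
  by move=> i; apply/matrixP => k l; rewrite !mxE irrelevant_mcoeff0.
by split=> //=; move=> *; apply: projective_rV.
Qed.

(* Modulo the irrelevant ideal the differentials of a minimal resolution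
   vanish, so the homotopy equivalence becomes an honest splitting there. *)
Lemma minimal_split gr rk Q dQ epsQ i : @minimal_free_resolution K n M gr rk ->
  @proj_resolution R M Q dQ epsQ ->
  exists (f : {linear 'rV[R]_(rk i.+1) -> Q i.+1})
    (g : {linear Q i.+1 -> 'rV[R]_(rk i.+1)}),
    mcoeff0_mx (lin1_mx (g \o f)) = 1%:M.
Proof.
move=> /minimal_row_resolution[D [e [resP D0]]] resQ.
have [f [g [h [h' E]]]] := comparison resP resQ i.
exists f, g.
have {E} : lin1_mx (g \o f) = 1%:M + lin1_mx h *m D i.+1 + D i *m lin1_mx h'.
  apply/row_matrixP => k; rewrite !rowE !mulmxDr mulmx1 !mulmxA !mul_rV_lin1/=.
  by rewrite -[LHS](subrK (delta_mx 0 k)) E/= addrC addrA.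
move=> ->; rewrite /mcoeff0_mx !map_mxD -!/(mcoeff0_mx _) !mcoeff0_mxM !D0.
by rewrite mulmx0 mul0mx !addr0 /mcoeff0_mx map_mx1.
Qed.

Lemma leq_size_mulmx1 p q (A : 'M[K]_(p, q)) (B : 'M[K]_(q, p)) :
  A *m B = 1%:M -> (p <= q)%N.
Proof.
move=> AB; rewrite -(mxrank1 K p) -AB.
exact: leq_trans (mxrankM_maxr _ _) (rank_leq_row _).
Qed.

(** Over K, the identity of size [rk i.+1] factors through a space of dimension [rk' i.+1]. *)
Lemma minimal_rank_le gr gr' rk rk' i :
  @minimal_free_resolution K n M gr rk -> @minimal_free_resolution K n M gr' rk' ->
  (rk i.+1 <= rk' i.+1)%N.
Proof.
move=> minP /minimal_row_resolution[D [e [resQ _]]].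
have [f [g fg]] := minimal_split i minP resQ.
apply: (@leq_size_mulmx1 _ _ (mcoeff0_mx (lin1_mx f)) (mcoeff0_mx (lin1_mx g))).
rewrite -mcoeff0_mxM -fg; congr mcoeff0_mx.
by apply/row_matrixP => k; rewrite !rowE mulmxA !mul_rV_lin1.
Qed.

Lemma betti_minimal gr rk i :
  @minimal_free_resolution K n M gr rk -> betti M gr i.+1 = rk i.+1.
Proof.
move=> min; rewrite /betti; case: xgetP => [r _ [rk' min' ->]|/(_ (rk i.+1))[]].
  by apply/eqP; rewrite eqn_leq (minimal_rank_le _ min min')
       (minimal_rank_le _ min' min).
by exists rk.
Qed.

(** Modulo the irrelevant ideal, the identity of size [rk i.+1] comes from a map that factors
    through [Q i.+1], which is 0 here. *)
Lemma minimal_rank_eq0 gr rk l i :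
  @minimal_free_resolution K n M gr rk -> has_proj_resolution M l ->
  (l <= i)%N -> rk i.+1 = 0%N.
Proof.
move=> minP [Q [dQ [epsQ [projQ surj e0 e z]]]] li.
have [f [g]] : exists (f : {linear 'rV[R]_(rk i.+1) -> Q i.+1})
    (g : {linear Q i.+1 -> 'rV[R]_(rk i.+1)}),
    mcoeff0_mx (lin1_mx (g \o f)) = 1%:M.
  exact: (minimal_split i minP (And4 projQ surj e0 e)).
have -> : lin1_mx (g \o f) = 0.
  apply/row_matrixP => k.
  by rewrite !rowE mul_rV_lin1 mulmx0/= (z i.+1 li (f _)) linear0.
rewrite /mcoeff0_mx map_mx0; case: (rk i.+1) => // k /matrixP/(_ 0 0)/eqP.
by rewrite !mxE eqxx eq_sym oner_eq0.
Qed.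

Lemma minimal_has_proj_resolution gr rk l :
  @minimal_free_resolution K n M gr rk -> (forall i, (l < i)%N -> rk i = 0%N) ->
  has_proj_resolution M l.
Proof.
move=> /minimal_row_resolution[D [g [[proj surj e0 e] _]]] z.
exists (fun i => 'rV[R]_(rk i) : lmodType R), (fun i => mulmxr (D i)), (rV_comb g).
split=> // i /z; move: (rk i) => m -> v; exact: thinmx0.
Qed.

(** The minimal resolution itself gives the upper bound; a shorter projective resolution would force
    the rank in degree d + 1 to vanish. *)
Lemma projdim_minimal gr rk d : @minimal_free_resolution K n M gr rk ->
  rk d.+1 != 0%N -> (forall i, (d.+1 < i)%N -> rk i = 0%N) -> projdim M = d.+1.
Proof.
move=> min rkd z; have res := minimal_has_proj_resolution min z.
have low l : has_proj_resolution M l -> (d.+1 <= l)%N.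
  move=> /(minimal_rank_eq0 min) resl; rewrite ltnNge; apply: contra rkd.
  by move/resl->.
rewrite /projdim /nat_min; case: xgetP => [l _ [lres lmin]|/(_ d.+1)[]//].
by apply/eqP; rewrite eqn_leq lmin// low.
Qed.

End MinimalRanks.

(** * Linear resolutions and mapping cones *)

Section LinearResolutions.

Set Implicit Arguments.
Unset Strict Implicit.
Import GRing.Theory.
Local Open Scope ring_scope.

(** Dependent choice in a family of types, since the components of a chain map are matrices of
    varying sizes. [Inv] records that the next choice is possible. *)
Lemma dependent_sequence (T : nat -> Type) (Inv : forall i, T i -> Prop)
    (Rel : forall i, T i -> T i.+1 -> Prop) (x0 : T 0%N) :
  Inv 0%N x0 ->
  (forall i x, Inv i x -> exists y, Inv i.+1 y /\ Rel i x y) ->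
  exists f : forall i, T i,
    f 0%N = x0 /\ forall i, Inv i (f i) /\ Rel i (f i) (f i.+1).
Proof.
move=> inv0 step.
pose next i (x : {x : T i | Inv i x}) : {y : T i.+1 | Inv i.+1 y} :=
  let y := cid (step i _ (svalP x)) in exist _ (sval y) (proj1 (svalP y)).
pose F := fix F i : {x : T i | Inv i x} :=
  if i is j.+1 then next j (F j) else exist _ x0 inv0.
exists (fun i => sval (F i)); split=> // i; split; first exact: svalP.
by rewrite /=; case: cid => y [].
Qed.

Variables (K : fieldType) (n : nat).
Local Notation R := {mpoly K[n]}.

Definition homog_mx d k l (A : 'M[R]_(k, l)) := forall i j, A i j \is d.-homog.

Lemma pihomogMr b d (p x : R) : x \is b.-homog ->
  pihomog mdeg (d + b) (p * x) = pihomog mdeg d p * x.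
Proof.
move=> xa; rewrite [in LHS](mpolyE p) mulr_suml linear_sum.
rewrite [in RHS](mpolyE p) linear_sum mulr_suml; apply: eq_bigr => m _ /=.
have mh : 'X_[m] * x \is (mdeg m + b).-homog by rewrite dhomogM ?dhomogX.
rewrite -scalerAl !linearZ -scalerAl /= pihomogX; congr (_ *: _).
case: eqP => [<-|md]; first by rewrite pihomog_dE.
rewrite mul0r (pihomog_ne0 _ mh)// eqn_add2r; exact/eqP.
Qed.

(** Solve the equation row by row, then keep the degree 1 part of each entry: comparing components
    of degree b + 1 shows that this is still a solution. *)
Lemma lift_homog_mx b k l m (A : 'M[R]_(k, l)) (B : 'M[R]_(m, l)) :
  homog_mx b A -> homog_mx b.+1 B ->
  (forall v : 'rV_m, exists w, w *m A = v *m B) ->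
  exists W, homog_mx 1 W /\ W *m A = B.
Proof.
move=> hA hB AB.
have /choice[w wP] : forall i, exists w : 'rV_k, w *m A = delta_mx 0 i *m B.
  by move=> i; apply: AB.
exists (map_mx (pihomog mdeg 1) (\matrix_i w i)); split=> [i j|].
  by rewrite mxE; exact: pihomogP.
apply/matrixP => i j; rewrite -(pihomog_dE (hB i j)).
have -> : B i j = \sum_x w i 0 x * A x j.
  by have /rowP/(_ j) := wP i; rewrite -rowE !mxE.
rewrite mxE linear_sum/=; apply: eq_bigr => x _.
by rewrite !mxE -(pihomogMr 1 (w i 0 x) (hA x j)).
Qed.

(* A resolution of the ideal J generated in degree q all of whose syzygies are
   linear, with [r i] the rank in homological degree i. *)
Definition lin_res (q : nat) (J : R -> Prop) (r : nat -> nat) : Prop :=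
  exists (e : 'cV[R]_(r 0%N)) (D : forall i, 'M[R]_(r i.+1, r i)),
    [/\ forall p, J p <-> exists v, v *m e = p%:M,
        forall v : 'rV_(r 0%N), v *m e = 0 <-> exists w, w *m D 0%N = v,
        forall i (v : 'rV_(r i.+1)), v *m D i = 0 <-> exists w, w *m D i.+1 = v,
        homog_mx q e & forall i, homog_mx 1 (D i)].

Lemma lin_res_ext q J J' r r' : (forall p, J p <-> J' p) -> r =1 r' ->
  lin_res q J r -> lin_res q J' r'.
Proof.
move=> JJ' /funext <- [e [D [HJ *]]]; exists e, D; split=> // p.
by rewrite -JJ'.
Qed.

Lemma lin_res0 q : lin_res q (fun p => p = 0) (fun => 0%N).
Proof.
exists 0, (fun=> 0); split=> [p|v|i v|i j|i k l]; last 2 first.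
- by rewrite mxE; exact: rpred0.
- by rewrite mxE; exact: rpred0.
- split=> [->|[v]]; first by exists 0; rewrite mulmx0 raddf0.
  by rewrite mulmx0 => /matrixP/(_ 0 0); rewrite !mxE eqxx mulr1n.
- by split=> _; [exists 0; rewrite mulmx0 [v]thinmx0|rewrite mulmx0].
- by split=> _; [exists 0; rewrite mulmx0 [v]thinmx0|rewrite mulmx0].
Qed.

(* The ranks of the resolution of the cyclic module R/J. *)
Definition cyclic_rank (s : nat -> nat) (i : nat) : nat :=
  if i is j.+1 then s j else 1%N.

(* The mapping cone of a lift of multiplication by u : R/(J : u) -> R/J.  All the
   data being linear, the lift can be taken with linear entries, whence
   minimality of the cone. *)
Lemma lin_res_cone q J r s (u : R) : u \is q.-homog -> lin_res q J r ->
  lin_res 1 (fun p => J (p * u)) s ->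
  lin_res q (fun p => exists y, J (p - y * u))
    (fun i => r i + cyclic_rank s i)%N.
Proof.
move=> hu [e [D [eJ De DD he hD]]] [e' [D' [eJ' De' DD' he' hD']]].
(* [C] resolves R/(J : u) instead of the ideal, so its differentials start with the generators
   [e']. *)
pose C i : 'M[R]_(cyclic_rank s i.+1, cyclic_rank s i) :=
  if i is j.+1 then D' j else e'.
have CC i (v : 'rV_(cyclic_rank s i.+1)) :
    v *m C i = 0 <-> exists w, w *m C i.+1 = v.
  by case: i v => [|i] v; [exact: De'|exact: DD'].
have CC0 i : C i.+1 *m C i = 0.
  apply/row_matrixP => k; rewrite row0 row_mul; apply/CC.
  by exists (delta_mx 0 k); rewrite rowE.
have hC i : homog_mx 1 (C i) by case: i.
(* The generators of J : u, multiplied by [u], are expressed through those of J. The degrees q + 1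
   and q leave linear entries. *)
have [f0 [hf0 f0e]] : exists W : 'M[R]_(s 0%N, r 0%N),
    homog_mx 1 W /\ W *m e = e' *m u%:M.
  apply: (lift_homog_mx he) => [i j|v].
    by rewrite mul_mx_scalar mxE -(addn1 q) dhomogM.
  rewrite mulmxA [v *m e']mx11_scalar -scalar_mxM; apply/eJ/eJ'.
  by exists v; exact: mx11_scalar.
(* The invariant says that [C i.+1] followed by the current component lands in the image of [D i],
   which is what the next lift needs. *)
have [f [f_0 fP]] : exists f : forall i, 'M[R]_(cyclic_rank s i.+1, r i),
    f 0%N = f0 /\ forall i, (homog_mx 1 (f i) /\
      forall w : 'rV_(cyclic_rank s i.+2),
        exists z, z *m D i = w *m (C i.+1 *m f i)) /\
      f i.+1 *m D i = C i.+1 *m f i.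
  apply: (@dependent_sequence (fun i => 'M[R]_(cyclic_rank s i.+1, r i))
    (fun i x => homog_mx 1 x /\
       forall w : 'rV_(cyclic_rank s i.+2),
         exists z, z *m D i = w *m (C i.+1 *m x))
    (fun i x y => y *m D i = C i.+1 *m x) f0).
    split=> // w; apply/De; rewrite -!mulmxA f0e -[e']/(C 0%N).
    by rewrite (mulmxA (C 1%N)) CC0 mul0mx mulmx0.
  move=> i x [hx xP].
  have [|y [hy yP]] := lift_homog_mx (hD i) _ xP.
    move=> k l; rewrite mxE; apply: rpred_sum => j _.
    by apply: (@dhomogM _ _ _ 1 _ 1); [exact: hC|exact: hx].
  exists y; split=> //; split=> // w; apply/DD.
  by rewrite -!mulmxA yP (mulmxA (C i.+2)) CC0 mul0mx mulmx0.
have {}fP : [/\ forall i, homog_mx 1 (f i), f 0%N *m e = C 0%N *m u%:M &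
    forall i, f i.+1 *m D i = C i.+1 *m f i].
  by split=> [i||i]; rewrite ?f_0//; have [[? ?] ?] := fP i.
move: fP => [hf fe fD] {f0 hf0 f0e f_0}.
have DE i (w : 'rV_(r i.+2)) : w *m D i.+1 *m D i = 0 by apply/DD; exists w.
have De0 (w : 'rV_(r 1%N)) : w *m D 0%N *m e = 0 by apply/De; exists w.
have CE i (w : 'rV_(cyclic_rank s i.+2)) : w *m C i.+1 *m C i = 0.
  by apply/CC; exists w.
(* The generators of the cone are those of J followed by [u]. The sign of [C] makes consecutive
   differentials compose to 0. *)
exists (col_mx e u%:M), (fun i => block_mx (D i) 0 (f i) (- C i)).
split=> [p|v|i v|i j|i k l].
- split=> [[y /eJ[v vP]]|[v]].
    exists (row_mx v y%:M).
    by rewrite mul_row_col vP -scalar_mxM -raddfD/= subrK.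
  rewrite -[v]hsubmxK mul_row_col [rsubmx v]mx11_scalar -scalar_mxM => vP.
  exists (rsubmx v 0 0); apply/eJ; exists (lsubmx v).
  by rewrite raddfB/= -vP addrK.
- rewrite -[v]hsubmxK; move: (lsubmx v) (rsubmx v) => a b {v}; split.
    rewrite mul_row_col => /eqP; rewrite addr_eq0 => /eqP ab.
    (* For a syzygy (a, b) of the cone, b lies in J : u and is thus the image of some y; then a + y
       f is a syzygy of J. Higher degrees work alike. *)
    have [y yb] : exists y, y *m C 0%N = b.
      have /eJ'[y yb] : J (b 0 0 * u).
        by apply/eJ; exists (- a); rewrite mulNmx ab opprK scalar_mxM -mx11_scalar.
      by exists y; rewrite yb -mx11_scalar.
    have /De[z zP] : (a + y *m f 0%N) *m e = 0.
      by rewrite mulmxDl ab -mulmxA fe mulmxA yb addNr.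
    exists (row_mx z (- y)); rewrite mul_row_block mulmx0 add0r mulmxN !mulNmx.
    by rewrite opprK zP yb addrK.
  move=> [w]; rewrite -[w]hsubmxK mul_row_block => /eq_row_mx[<- <-].
  rewrite mul_row_col mulmx0 add0r mulmxDl De0 add0r -!mulmxA fe mulNmx mulmxN.
  by rewrite subrr.
- rewrite -[v]hsubmxK; move: (lsubmx v) (rsubmx v) => a b {v}; split.
    rewrite mul_row_block mulmx0 add0r -[0]row_mx0 => /eq_row_mx[ab].
    rewrite mulmxN => /eqP; rewrite oppr_eq0 => /eqP/CC[y yb].
    have /DD[z zP] : (a + y *m f i.+1) *m D i = 0.
      by rewrite mulmxDl -mulmxA fD mulmxA yb ab.
    exists (row_mx z (- y)); rewrite mul_row_block mulmx0 add0r mulmxN !mulNmx.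
    by rewrite opprK zP yb addrK.
  move=> [w]; rewrite -[w]hsubmxK mul_row_block => /eq_row_mx[<- <-].
  rewrite mul_row_block !mulmx0 !add0r mulmxDl DE add0r -[0]row_mx0; congr row_mx.
    by rewrite -!mulmxA fD mulNmx mulmxN subrr.
  by rewrite !mulmxN mulNmx opprK CE.
- by rewrite mxE; case: split => k; rewrite ?he// [k]ord1 [j]ord1 mxE mulr1n.
- rewrite mxE; case: split => ?; rewrite mxE; case: split => ?; rewrite ?hD ?hf//.
    by rewrite mxE; exact: rpred0.
  by rewrite mxE rpredN; exact: hC.
Qed.

End LinearResolutions.

(** * Monomial ideals and the Koszul complex *)

Section MonomialIdeals.

Set Implicit Arguments.
Unset Strict Implicit.
Import GRing.Theory.
Local Open Scope ring_scope.

Variables (K : fieldType) (n : nat).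
Local Notation R := {mpoly K[n]}.
Implicit Types (A B : set 'X_{1..n}) (p : R) (m u : 'X_{1..n}).

Definition mon_multiple A m : Prop := exists2 a, A a & (a <= m)%MM.

(** Membership is tested on the support, so that colons and sums with a monomial turn into
    divisibility of exponents. *)
Definition mon_ideal A p : Prop := forall m, m \in msupp p -> mon_multiple A m.

Lemma mon_ideal_gen A p :
  p \in ideal_gen [set p | exists2 m, A m & p = 'X_[m]] <-> mon_ideal A p.
Proof.
split=> [/ideal_genP[s sA ->] m /msupp_sum_le/flattenP[x /mapP[c]]|Ap].
  rewrite mem_filter => /andP[_ /sA[a Aa ->]] ->{x}.
  rewrite (perm_mem (msuppMX _ _)) => /mapP[k _ ->]; exists a => //.
  exact: lem_addr.
rewrite (mpolyE p) big_seq; apply: rpred_sum => m /Ap[a Aa am].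
rewrite -(submK am) mpolyXD -mul_mpolyC mulrA; apply: ideal_gen_mull.
apply/ideal_genP; exists [:: (1, 'X_[a])]; last by rewrite big_seq1 mul1r.
by move=> c; rewrite inE => /eqP->; exists a.
Qed.

Lemma mon_ideal_ext A B p : (forall m, A m <-> B m) ->
  mon_ideal A p <-> mon_ideal B p.
Proof. by move=> AB; split=> I m /I[a /AB]; exists a. Qed.

Lemma mon_ideal0 p : mon_ideal set0 p <-> p = 0.
Proof.
split=> [H|-> m]; last by rewrite msupp0.
apply: msuppnil0; case E: (msupp p) => [//|m s].
by have := H m; rewrite E mem_head => /(_ isT)[].
Qed.

Lemma mon_ideal_colon A B u p :
  (forall m, mon_multiple A (u + m)%MM <-> mon_multiple B m) ->
  mon_ideal A (p * 'X_[u]) <-> mon_ideal B p.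
Proof.
move=> AB; split=> I m.
  by move=> mp; apply/AB/I; rewrite (perm_mem (msuppMX _ _)) map_f.
by rewrite (perm_mem (msuppMX _ _)) => /mapP[k /I/AB kp ->].
Qed.

Lemma mon_ideal_addX A u p :
  (exists y, mon_ideal A (p - y * 'X_[u])) <-> mon_ideal [set m | m = u \/ A m] p.
Proof.
split=> [[y yA] m mp|I].
  have : p = (p - y * 'X_[u]) + y * 'X_[u] by rewrite subrK.
  move=> pE; move: mp; rewrite pE => /msuppD_le; rewrite mem_cat => /orP[/yA[b]|].
    by exists b => //; right.
  rewrite (perm_mem (msuppMX _ _)) => /mapP[k _ ->]; exists u; first by left.
  exact: lem_addr.
(* The witness collects the quotients of the terms of [p] divisible by the monomial of [u]; the
   difference keeps only the other terms. *)
exists (\sum_(m <- msupp p | (u <= m)%MM) p@_m *: 'X_[m - u]).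
have -> : p - (\sum_(m <- msupp p | (u <= m)%MM) p@_m *: 'X_[m - u]) * 'X_[u]
    = \sum_(m <- msupp p | ~~ (u <= m)%MM) p@_m *: 'X_[m].
  rewrite mulr_suml {1}(mpolyE p) (bigID (fun m => u <= m)%MM)/= addrAC.
  rewrite -[RHS]add0r; congr (_ + _); apply/eqP; rewrite subr_eq0; apply/eqP.
  by apply: eq_bigr => m um; rewrite -scalerAl -mpolyXD submK.
move=> m /msupp_sum_le/flattenP[x /mapP[k]]; rewrite mem_filter.
move=> /andP[uk kp] ->{x}.
move/msuppZ_le; rewrite msuppX inE => /eqP->.
by have [b [->|]] := I _ kp; [rewrite (negPf uk)|exists b].
Qed.

(** The last hypothesis says that [B] generates the colon by [u] of the ideal of [A]. This is the
    inductive step for linear quotients. *)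
Lemma lin_res_addX A B u r s : lin_res (mdeg u) (mon_ideal A) r ->
  lin_res 1 (mon_ideal B) s ->
  (forall m, mon_multiple A (u + m)%MM <-> mon_multiple B m) ->
  lin_res (mdeg u) (mon_ideal [set m | m = u \/ A m])
    (fun i => r i + cyclic_rank s i)%N.
Proof.
move=> rA sB AB.
have Xu : ('X_[u] : R) \is (mdeg u).-homog by rewrite dhomogX.
have : lin_res 1 (fun p => mon_ideal A (p * 'X_[u])) s.
  by apply: lin_res_ext sB => // p; exact: iff_sym (mon_ideal_colon p AB).
by move/(lin_res_cone Xu rA); apply: lin_res_ext => // p; exact: mon_ideal_addX.
Qed.

Lemma lin_res_set0 q : lin_res q (@mon_ideal set0) (fun=> 0%N).
Proof. by apply: lin_res_ext (@lin_res0 K n q) => // p; rewrite mon_ideal0. Qed.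

(* The Koszul complex, built one variable at a time. *)
Lemma lin_res_variables (ts : seq 'I_n) : uniq ts ->
  lin_res 1 (mon_ideal [set m | exists2 j, j \in ts & m = U_(j)%MM])
    (fun i => 'C(size ts, i.+1)).
Proof.
elim: ts => [_|t ts IH /= /andP[tts /IH {}IH]].
  apply: lin_res_ext (lin_res_set0 1) => // p.
  by apply: mon_ideal_ext => m; split=> // -[].
(* [IH] serves both for the ideal of [ts] and for its colon by the variable [t]; the ranks add up by
   Pascal's rule. *)
have := @lin_res_addX _ _ U_(t)%MM _ _; rewrite mdeg1 => /(_ _ _ _ _ IH IH) res.
apply: lin_res_ext (res _) => [p|[|i]|m] /=.
- apply: mon_ideal_ext => m; split=> [[->|[j jts ->]]|[j]].
  + by exists t; rewrite ?mem_head.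
  + by exists j; rewrite // in_cons jts orbT.
  by rewrite in_cons => /orP[/eqP->|jts] ->; [left|right; exists j].
- by rewrite binS bin0.
- by rewrite binS.
- split=> -[_ [j jts ->] jm]; exists U_(j)%MM; try by exists j.
    apply/mnm_lepP => k; have /mnm_lepP/(_ k) := jm.
    rewrite mnmDE !mnm1E; case: (j =P k) => // <-.
    by case: eqP => // tj; rewrite tj jts in tts.
  by apply: lepm_trans jm _; rewrite addmC; exact: lem_addr.
Qed.

End MonomialIdeals.

(** * Polarized monomials and linear quotients *)

Section Polarization.

Set Implicit Arguments.
Unset Strict Implicit.

Variables (n : nat) (b : 'I_n -> nat).

(** For [b := bexp I] this unfolds to the same type as [wpvar I]; a general [b] keeps the
    combinatorics free of the ideal. *)
Definition pvar : finType := {i : 'I_n & 'I_(b i)}.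
Definition pvar_row (x : pvar) : 'I_n := tag x.
Definition pvar_col (x : pvar) : 'I_(b (pvar_row x)) := tagged x.
Definition var i (k : 'I_(b i)) : 'I_#|pvar| :=
  enum_rank (Tagged (fun i => 'I_(b i)) k : pvar).

Implicit Types u v : 'X_{1..n}.

(* The exponent of x_(1, u 1 + 1) ... x_(n, u n + 1): for k : 'I_(b i), [var k] is
   the index of x_(i, k + 1). *)
Definition polar u : 'X_{1..#|pvar|} :=
  [multinom
    (pvar_col (enum_val j) == u (pvar_row (enum_val j)) :> nat) : nat | j < _].

Definition below u : seq 'I_#|pvar| :=
  enum [pred j : 'I_#|pvar| | pvar_col (enum_val j) < u (pvar_row (enum_val j))].

Definition bounded u := forall i, u i < b i.

Lemma polarE u i (k : 'I_(b i)) : polar u (var k) = (k == u i :> nat).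
Proof. by rewrite mnmE enum_rankK. Qed.

Lemma mem_below u i (k : 'I_(b i)) : (var k \in below u) = (k < u i).
Proof. by rewrite mem_enum inE enum_rankK. Qed.

Lemma varP (j : 'I_#|pvar|) : exists i (k : 'I_(b i)), j = var k.
Proof.
exists (pvar_row (enum_val j)), (pvar_col (enum_val j)); rewrite /var taggedK.
by rewrite enum_valK.
Qed.

Lemma sum_var (F : forall i : 'I_n, 'I_(b i) -> nat) :
  \sum_(j < #|pvar|) F _ (pvar_col (enum_val j)) = \sum_i \sum_(k < b i) F i k.
Proof.
rewrite sig_big_dep/= (reindex (@enum_val pvar predT))//.
by apply: onW_bij; exact: enum_val_bij.
Qed.

Lemma mdeg_polar u : bounded u -> mdeg (polar u) = n.
Proof.
move=> ub; rewrite mdegE; under eq_bigr do rewrite mnmE.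
rewrite (sum_var (fun i k => (k == u i :> nat) : nat)) -[RHS]card_ord -sum1_card.
apply: eq_bigr => i _; rewrite (bigD1 (Ordinal (ub i)))//= eqxx big1// => k.
by rewrite -val_eqE/= => /negPf->.
Qed.

Lemma size_below u : bounded u -> size (below u) = mdeg u.
Proof.
move=> ub; rewrite -cardE -sum1_card mdegE big_mkcond/=.
rewrite (sum_var (fun i k => if k < u i then 1 else 0)); apply: eq_bigr => i _.
rewrite -big_mkcond/= -(big_ord_widen _ (fun=> 1)); last exact: ltnW.
by rewrite sum1_card card_ord.
Qed.

Lemma seq_max (T : eqType) (f : T -> nat) (s : seq T) : s != [::] ->
  exists2 x, x \in s & {in s, forall y, f y <= f x}.
Proof.
elim: s => // x s; have [->_ _|_ /(_ isT)[y ys yP] _] := eqVneq s [::].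
  by exists x; rewrite ?mem_head// => y; rewrite inE => /eqP->.
have [xy|/ltnW yx] := leqP (f x) (f y).
  exists y; first by rewrite in_cons ys orbT.
  by move=> z; rewrite in_cons => /predU1P[->//|/yP].
exists x; rewrite ?mem_head// => z; rewrite in_cons => /predU1P[->//|/yP zy].
exact: leq_trans zy yx.
Qed.

Lemma lem_mdeg_eq u v : (u <= v)%MM -> mdeg v <= mdeg u -> u = v.
Proof.
move=> uv; rewrite -{1}(submK uv) mdegD -[leqRHS]add0n leq_add2r leqn0 mdeg_eq0.
by move=> /eqP vu; rewrite -(submK uv) vu add0m.
Qed.

(* If v i < u i then x_v / gcd(x_v, x_u) is a multiple of x_(i, v i + 1), and this
   variable is in the colon ideal since u with u i lowered to v i is in [us]. *)
Lemma polar_colon (us : seq 'X_{1..n}) u :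
  (forall v, v \in us -> bounded v) ->
  (forall v, (v <= u)%MM -> v != u -> v \in us) -> bounded u ->
  (forall v, v \in us -> ~~ (u <= v)%MM) -> forall m,
  mon_multiple [set m | exists2 v, v \in us & m = polar v] (polar u + m)%MM <->
  mon_multiple [set m | exists2 j, j \in below u & m = U_(j)%MM] m.
Proof.
move=> usb uscl ub usNu m; split=> [[_ [v vus ->] vm]|[_ [j ju ->] jm]].
  have /existsP[i] : [exists i, v i < u i].
    apply: contraR (usNu _ vus); rewrite negb_exists => /forallP uv.
    by apply/mnm_lepP => i; rewrite leqNgt uv.
  move=> vui; pose k := Ordinal (usb v vus i).
  exists U_(var k)%MM; first by exists (var k); rewrite ?mem_below.
  rewrite lep1mP -lt0n; have /mnm_lepP/(_ (var k)) := vm.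
  by rewrite mnmDE !polarE/= eqxx (ltn_eqF vui).
have [i [k jE]] := varP j; subst j; move: ju; rewrite mem_below => ku.
pose v := [multinom if l == i then k : nat else u l | l < n].
have vu : v != u by apply: contraTneq ku => <-; rewrite mnmE eqxx ltnn.
exists (polar v).
  exists v => //; apply: uscl => //; apply/mnm_lepP => l; rewrite mnmE.
  by case: eqP => // ->; exact: ltnW.
apply/mnm_lepP => j; have [l [h ->]] := varP j.
rewrite mnmDE !polarE mnmE; case: (l =P i) => [li|_]; last exact: leq_addr.
subst l; case: (h =P k :> nat) => // /val_inj->.
move: jm; rewrite lep1mP -lt0n => jm.
exact: leq_trans jm (leq_addl _ _).
Qed.

(** Induction removing a monomial [u] of largest degree: what remains is still closed under divisors
    and [u] divides none of it, so [polar_colon] gives a colon ideal generated by the variables in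
    [below u]. *)
Lemma lin_res_polar (K : fieldType) (us : seq 'X_{1..n}) : uniq us ->
  (forall u, u \in us -> bounded u) ->
  (forall u v, u \in us -> (v <= u)%MM -> v \in us) ->
  lin_res n (@mon_ideal K _ [set m | exists2 u, u \in us & m = polar u])
    (fun i => \sum_(u <- us) 'C(mdeg u, i)).
Proof.
move: {2}(size us) (leqnn (size us)) => N; elim: N us => [|N IH] us.
  rewrite leqn0 size_eq0 => /eqP-> _ _ _.
  apply: lin_res_ext (lin_res_set0 K _ n) => [p|i]; last by rewrite big_nil.
  by apply: mon_ideal_ext => m; split=> // -[].
move=> usN us_uniq usb uscl.
have [us0|/(seq_max (@mdeg n))[u uus umax]] := eqVneq us [::].
  by apply: IH; rewrite ?us0.
have remP v : (v \in rem u us) = (v != u) && (v \in us) by rewrite mem_rem_uniq.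
have colon := @polar_colon (rem u us) u.
have usNu v : v \in rem u us -> ~~ (u <= v)%MM.
  rewrite remP => /andP[vu vus]; apply: contra vu => uv.
  by rewrite (lem_mdeg_eq uv)// umax.
have := @lin_res_addX K _ [set m | exists2 v, v \in rem u us & m = polar v]
  [set m | exists2 j, j \in below u & m = U_(j)%MM] (polar u).
rewrite mdeg_polar; last exact: usb.
move=> /(_ _ _ (IH (rem u us) _ _ _ _) (lin_res_variables K (enum_uniq _))) res.
apply: lin_res_ext (res _ _ _ _ _) => [p|i|||v|v w|m].
- apply: mon_ideal_ext => m; split=> [[->|[v]]|[v vus ->]]; first by exists u.
    by rewrite remP => /andP[_ vus] ->; exists v.
  have [->|vu] := eqVneq v u; first by left.
  by right; exists v; rewrite // remP vu.
(* With d the degree of [u], the Koszul ranks C(d, i + 1), preceded by the 1 of [cyclic_rank], form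
   the sequence C(d, i). *)
- rewrite (perm_big _ (perm_to_rem uus)) big_cons addnC; congr addn.
  by rewrite size_below; [case: i => //=; rewrite bin0|exact: usb].
- by rewrite size_rem// -ltnS prednK//; case: (us) uus.
- exact: rem_uniq.
- by rewrite remP => /andP[_ /usb].
- rewrite !remP => /andP[vu vus] wv; rewrite (uscl v)// andbT.
  by apply: contraNneq (usNu v _) => [<-//|]; rewrite remP vu.
- apply: colon => [v|v vu vNu||]; last exact: usNu.
  + by rewrite remP => /andP[_ /usb].
  + by rewrite remP vNu (uscl u).
  exact: usb.
Qed.

End Polarization.

(** * Least and greatest elements of sets of naturals *)

Lemma nat_minP (A : set nat) d : A d ->
  A (nat_min A) /\ forall e, A e -> (nat_min A <= e)%N.
Proof.
move=> Ad; rewrite /nat_min; case: xgetP => [x _ //|noA]; exfalso.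
have exA : exists e, `[< A e >] by exists d; apply/asboolP.
case: (ex_minnP exA) => m /asboolP Am minm; apply: (noA m).
by split=> // e Ae; apply/minm/asboolP.
Qed.

Lemma nat_maxE (A : set nat) d : A d -> (forall e, A e -> (e <= d)%N) ->
  nat_max A = d.
Proof.
move=> Ad maxd; rewrite /nat_max; case: xgetP => [x _ [Ax maxx]|/(_ d)[]//].
by apply/eqP; rewrite eqn_leq maxd// maxx.
Qed.

(** * Artinian monomial ideals and finiteness of [Mon] *)

Section ArtinianMonomialIdeals.

Set Implicit Arguments.
Unset Strict Implicit.
Import GRing.Theory.
Local Open Scope ring_scope.

Lemma kernel_prime (R : comNzRingType) (T : idomainType) (f : {rmorphism R -> T}) :
  idealr_closed [pred x | f x == 0] /\ prime_idealr_closed [pred x | f x == 0].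
Proof.
split; last by move=> u v; rewrite !inE rmorphM mulf_eq0.
split; rewrite ?inE ?rmorph0 ?rmorph1 ?oner_eq0// => a u v; rewrite !inE.
by move=> /eqP u0 /eqP v0; rewrite rmorphD rmorphM u0 v0 mulr0 addr0.
Qed.

Variables (K : fieldType) (n : nat) (I : {pred {mpoly K[n]}}).
Local Notation R := {mpoly K[n]}.
Hypothesis I_mon : monomial_ideal I.

Lemma ideal_gen_monomial : ideal_gen [set` I] =i I.
Proof.
have [A IA] := I_mon; move=> p; apply/idP/idP => [/ideal_genP[s sI ->]|pI].
  rewrite IA big_seq; apply: rpred_sum => c /sI cI.
  by apply: ideal_gen_mull; rewrite -IA.
apply/ideal_genP; exists [:: (1, p)]; last by rewrite big_seq1 mul1r.
by move=> c; rewrite inE => /eqP->.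
Qed.

Lemma in_monomial_ideal p : p \in I <-> forall m, m \in msupp p -> ~ Mon I m.
Proof.
have [A IA] := I_mon; have {}IA q : q \in I <-> mon_ideal A q.
  by rewrite IA; exact: mon_ideal_gen.
have XA m : ~ Mon I m <-> mon_multiple A m.
  rewrite /Mon/=; split=> [/negP/negPn/IA|mA].
    by apply; rewrite msuppX mem_head.
  by apply/negP/negPn/IA => k; rewrite msuppX inE => /eqP->.
by rewrite IA; split=> H m /H /XA.
Qed.

Lemma Mon_le u v : Mon I u -> (v <= u)%MM -> Mon I v.
Proof.
move=> uM vu; move: uM; rewrite -(submK vu) /Mon/= mpolyXD -!ideal_gen_monomial.
by apply: contraNN; exact: ideal_gen_mull.
Qed.

Hypothesis I_dim0 : krull_dim_quot I 0.

(** A prime chain of length 0 provides a proper ideal containing [I], so 1 is not in [I]. *)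
Lemma Mon0 : Mon I 0%MM.
Proof.
have [[P [/(_ 0%N isT)[[_ P1 _] _ IP] _]] _] := I_dim0.
by rewrite /Mon/= mpolyX0; apply: contra P1; exact: IP.
Qed.

(* Otherwise (X_j : j <> i) would be a prime ideal containing I, and not a
   maximal one: both this ideal and (X_1, ..., X_n) are kernels of evaluations. *)
Lemma power_in_artinian i : exists k, (1 <= k)%N /\ ('X_i : R) ^+ k \in I.
Proof.
apply: contrapT => noI.
(* Descending from the exponent k + 1 covers k = 0, about which [noI] says nothing. *)
have noXi k : Mon I (U_(i) *+ k)%MM.
  apply: (@Mon_le (U_(i) *+ k.+1)%MM).
    by apply/negP => kI; apply: noI; exists k.+1; rewrite mpolyXn.
  by apply/mnm_lepP => j; rewrite !mulmnE leq_mul2l leqnSn orbT.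
pose lq : n.-tuple R := [tuple if j == i then 'X_i else 0 | j < n].
pose P1 : {pred R} := [pred p | meval (fun=> 0) p == 0].
pose P0 : {pred R} := [pred p | comp_mpoly lq p == 0].
have lqE j : tnth lq j = if j == i then 'X_i else 0 by rewrite tnth_mktuple.
suff /(I_dim0.2 _) : prime_chain I 1 by [].
have P01 : {subset P0 <= P1}.
  move=> p; rewrite !inE => /eqP p0.
  rewrite -(_ : (p \mPo lq).@[fun=> 0] = p.@[fun=> 0]).
    by rewrite p0 meval0.
  rewrite comp_mpoly_meval; apply: meval_eq => j; rewrite lqE.
  by case: eqP => _; rewrite ?meval0// mevalXU.
exists (fun k => if k is 0%N then P0 else P1); split; last first.
  case=> // _; split=> //; exists 'X_i; first by rewrite inE mevalXU.
  by rewrite inE comp_mpolyXU -(tnth_nth 0) lqE eqxx -msupp_eq0 msuppX.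
(* A monomial of [I] is no power of X_i, so some other variable divides it and the substitution [lq]
   kills it. *)
move=> k _; have IP0 : {subset I <= P0}.
  move=> p /in_monomial_ideal pI; rewrite inE [p]mpolyE linear_sum big1_seq// => m.
  move=> /andP[_ /pI mI].
  have [j /andP[ji mj]] : exists j, (j != i) && (m j != 0%N).
    apply/existsP; apply: contrapT => /negP; rewrite negb_exists => /forallP m0.
    apply: mI; apply: Mon_le (noXi (m i)) _; apply/mnm_lepP => j.
    rewrite mulmnE mnm1E; case: eqP => [<-|/eqP ij]; first by rewrite mul1n.
    by have := m0 j; rewrite eq_sym ij/= negbK => /eqP->.
  rewrite linearZ/= comp_mpolyX (bigD1 j)//= lqE (negPf ji) expr0n (negPf mj).
  by rewrite mul0r scaler0.
case: k => [|k].
  by have [? ?] := kernel_prime (comp_mpoly lq).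
have [? ?] := kernel_prime (meval (fun=> 0) : {rmorphism R -> K}).
by split=> // p /IP0/P01.
Qed.

Lemma bexpP i : (1 <= bexp I i)%N /\ ('X_i : R) ^+ bexp I i \in I.
Proof.
have [k kP] := power_in_artinian i.
by have [] := @nat_minP [set k | (1 <= k)%N /\ ('X_i : R) ^+ k \in I] k kP.
Qed.

Lemma Mon_bounded u : Mon I u -> bounded (bexp I) u.
Proof.
move=> uM i; rewrite ltnNge; apply/negP => bu; have [_] := bexpP i.
rewrite mpolyXn; apply/negP; apply: Mon_le uM _; apply/mnm_lepP => j.
by rewrite mulmnE mnm1E; case: eqP => [<-|]; rewrite ?mul1n.
Qed.

Lemma Mon_enum : exists us : seq 'X_{1..n},
  uniq us /\ forall u, u \in us <-> Mon I u.
Proof.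
(* Bounded exponents bound the degree, which places [Mon I] in a finite type of monomials; the
   degree bound there is strict, hence the successor. *)
pose D := (\sum_i bexp I i).+1.
exists [seq bmnm m | m <- enum {: 'X_{1..n < D}} & `[< Mon I (bmnm m) >]]; split.
  rewrite map_inj_uniq; first exact/filter_uniq/enum_uniq.
  by move=> x y; exact: val_inj.
move=> u; split=> [/mapP[m]|uM].
  by rewrite mem_filter => /andP[/asboolP + _] ->.
have uD : (mdeg u < D)%N.
  by rewrite mdegE ltnS leq_sum// => i _; exact/ltnW/Mon_bounded.
apply/mapP; exists (BMultinom uD) => //.
by rewrite mem_filter mem_enum andbT; apply/asboolP.
Qed.

Lemma Lgens_polar : Lgens I =
  [set p | exists2 m, [set m | exists2 u, Mon I u & m = polar (bexp I) u] m &
           p = 'X_[m]].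
Proof.
have prodE (u : 'X_{1..n}) (a : forall i, 'I_(bexp I i)) :
    (forall i, a i = u i :> nat) ->
    \prod_(i < n) xvar (a i) = 'X_[polar (bexp I) u] :> {mpoly K[#|wpvar I|]}.
  move=> au; rewrite /xvar mprodXE; congr ('X_[_]); apply/mnmP => j.
  have [l [h ->]] := varP j; rewrite mnm_sumE polarE (bigD1 l)//= mnm1E.
  rewrite big1 => [|i il].
    rewrite addn0 (inj_eq enum_rank_inj) -tag_eqE /tag_eq/= eqxx tagged_asE/=.
    by rewrite -val_eqE/= au eq_sym.
  rewrite mnm1E (inj_eq enum_rank_inj); apply/eqP; rewrite eqb0.
  by apply: contraNneq il => /(congr1 tag)/= ->.
apply/seteqP; split=> [p [u uM [a au ->]]|p [_ [u uM ->] ->]].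
  by exists (polar (bexp I) u); [exists u|exact: prodE].
have ub := Mon_bounded uM.
by exists u => //; exists (fun i => Ordinal (ub i)) => //; rewrite (@prodE u).
Qed.

End ArtinianMonomialIdeals.

(** * Hilbert function, and minimal resolutions of cyclic modules *)

Section HilbertFunction.

Set Implicit Arguments.
Unset Strict Implicit.
Import GRing.Theory.
Local Open Scope ring_scope.

Variables (K : fieldType) (n : nat).
Local Notation R := {mpoly K[n]}.

(** Writing each family in terms of the other gives two matrices over K, whose product is the
    identity because [e] is free. *)
Lemma Kbasis_le (M : lmodType R) (U : set M) d d' (e : 'I_d -> M)
    (e' : 'I_d' -> M) :
  is_Kbasis U e -> is_Kbasis U e' -> (d <= d')%N.
Proof.
move=> [Ue free span] [Ue' _ span'].
have /choice[c cP] : forall k,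
    exists c : 'I_d' -> K, e k = \sum_l (c l)%:MP *: e' l.
  by move=> k; exact/span'/Ue.
have /choice[c' c'P] : forall l,
    exists c : 'I_d -> K, e' l = \sum_k (c k)%:MP *: e k.
  by move=> l; exact/span/Ue'.
apply: (@leq_size_mulmx1 _ _ _ (\matrix_(k, l) c k l) (\matrix_(l, k) c' l k)).
apply/matrixP => k m; rewrite !mxE; apply/eqP; rewrite -subr_eq0; apply/eqP.
apply: (free (fun m => _ - (k == m)%:R)) m.
have E m : ((\sum_j (\matrix_(k, l) c k l) k j * (\matrix_(l, k) c' l k) j m -
    (k == m)%:R)%:MP : R) *: e m =
    \sum_j (c k j)%:MP *: ((c' j m)%:MP *: e m) - (k == m)%:R *: e m.
  rewrite raddfB raddf_sum/= scalerBl scaler_suml; congr (_ - _).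
    by apply: eq_bigr => j _; rewrite !mxE mpolyCM scalerA.
  by rewrite rmorph_nat.
under eq_bigr do rewrite E.
rewrite sumrB exchange_big/= (bigD1 k)//= eqxx scale1r [X in _ - (_ + X)]big1 ?addr0.
  under eq_bigr do rewrite -scaler_sumr -c'P.
  by rewrite -cP subrr.
by move=> j /negPf jk; rewrite eq_sym jk scale0r.
Qed.

Lemma KdimE (M : lmodType R) (U : set M) d (e : 'I_d -> M) :
  is_Kbasis U e -> Kdim U = d.
Proof.
move=> eb; rewrite /Kdim; case: xgetP => [d' _ [e' e'b]|/(_ d)[]]; last by exists e.
by apply/eqP; rewrite eqn_leq (Kbasis_le e'b eb) (Kbasis_le eb e'b).
Qed.

Local Notation qmorph G :=
  (\pi_(Quotient.quot (ideal_gen G : GRing.ZmodClosed.type R))%qT).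

Lemma qpi0 (G : set R) : qpi G 0 = 0.
Proof. exact: (raddf0 (qmorph G)). Qed.

Lemma qpi_sum (G : set R) J (s : seq J) (P : pred J) (F : J -> R) :
  qpi G (\sum_(j <- s | P j) F j) = \sum_(j <- s | P j) qpi G (F j).
Proof. exact: (raddf_sum (qmorph G)). Qed.

(** The classes of the monomials of degree [j] outside [I] form a basis: a polynomial lies in [I]
    only if all its monomials do. *)
Lemma hcompE (I : {pred R}) (us : seq 'X_{1..n}) j : monomial_ideal I ->
  uniq us -> (forall u, u \in us <-> Mon I u) ->
  hcomp I j = count (fun u => mdeg u == j) us.
Proof.
move=> I_mon us_uniq usM; rewrite -size_filter.
set s := filter _ _; have s_uniq : uniq s by rewrite filter_uniq.
pose x (k : 'I_(size s)) := nth 0%MM s k.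
have xinj : injective x.
  by move=> k l /eqP; rewrite nth_uniq// => /eqP/val_inj.
have xs k : x k \in s by rewrite mem_nth.
have xM k : Mon I (x k) by apply/usM; have := xs k; rewrite mem_filter => /andP[].
have qE p q : qpi [set` I] p = qpi [set` I] q <-> p - q \in I.
  by rewrite qpiP ideal_gen_monomial.
have combE (c : 'I_(size s) -> K) :
    \sum_k (c k)%:MP *: qpi [set` I] 'X_[x k] =
    qpi [set` I] (\sum_k c k *: 'X_[x k]).
  rewrite qpi_sum; apply: eq_bigr => k _.
  by rewrite -mul_mpolyC; exact: qscale_pi.
have coefE (c : 'I_(size s) -> K) k : (\sum_l c l *: 'X_[x l])@_(x k) = c k.
  rewrite raddf_sum (bigD1 k)//= big1 => [|l lk]; last first.
    by rewrite mcoeffZ mcoeffX (inj_eq xinj) (negPf lk) mulr0.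
  by rewrite mcoeffZ mcoeffX eqxx mulr1 addr0.
apply: (@KdimE _ _ _ (fun k => qpi [set` I] 'X_[x k])); split.
- move=> k; exists j; split=> //; exists 'X_[x k] => //.
  by rewrite dhomogX; have := xs k; rewrite mem_filter => /andP[].
- move=> c; rewrite combE -(qpi0 [set` I]) => /qE; rewrite subr0.
  move=> /(in_monomial_ideal I_mon) cI k; apply/eqP; apply: contrapT => ck.
  by apply: (cI (x k)) (xM k); rewrite mcoeff_msupp coefE; exact/negP.
- move=> _ [_ [[<-]] [p pj ->]]; exists (fun k => p@_(x k)); rewrite combE.
  (* The difference has no monomial outside [I]: those of degree [j] cancel, and the others do not
     occur. *)
  apply/qE/(in_monomial_ideal I_mon) => m + mM; rewrite mcoeff_msupp mcoeffB.
  have [mj|mj] := eqVneq (mdeg m) j.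
    have ms : m \in s by rewrite mem_filter mj eqxx; exact/usM.
    have mi : (index m s < size s)%N by rewrite index_mem.
    have -> : m = x (Ordinal mi) by rewrite /x/= nth_index.
    by rewrite coefE subrr eqxx.
  rewrite (dhomog_nemf_coeff pj mj) raddf_sum big1 ?subrr ?eqxx// => k _ /=.
  rewrite mcoeffZ mcoeffX; case: eqP => [xk|]; last by rewrite mulr0.
  by have := xs k; rewrite mem_filter xk (negPf mj).
Qed.

Lemma sum_hcomp (I : {pred R}) (us : seq 'X_{1..n}) i : monomial_ideal I ->
  uniq us -> (forall u, u \in us <-> Mon I u) ->
  \big[addn/0%N]_(j \in [set: nat]) (hcomp I j * 'C(j, i))%N =
    (\sum_(u <- us) 'C(mdeg u, i))%N.
Proof.
(* [B] exceeds all degrees in [us], so only [j] below [B] contribute; the two finite sums are then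
   exchanged. *)
move=> I_mon us_uniq usM; pose B := (\sum_(u <- us) (mdeg u).+1)%N.
have usB u : u \in us -> (mdeg u < B)%N.
  by move=> uus; rewrite /B (big_rem u)//= leq_addr.
have hE j : hcomp I j = (\sum_(u <- us) (mdeg u == j))%N.
  by rewrite (hcompE j I_mon us_uniq usM) -sum1_count big_mkcond.
rewrite -(fsbig_widen `I_B setT)//; last first.
  move=> j [_ /negP jB] /=; rewrite hE big_seq big1// => u /usB uB.
  by case: eqP => // uj; rewrite -uj uB in jB.
rewrite -fsbig_ord.
transitivity (\sum_(j < B) \sum_(u <- us) (mdeg u == j) * 'C(j, i))%N.
  by apply: eq_bigr => j _; rewrite hE big_distrl.
rewrite exchange_big/= big_seq [RHS]big_seq; apply: eq_bigr => u /usB uB.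
rewrite (bigD1 (Ordinal uB))//= eqxx mul1n big1 ?addn0// => j.
by rewrite -val_eqE/= eq_sym => /negPf->.
Qed.


(** Positivity of [q] gives minimality of F_1 -> F_0: the entries of [e] have degree [q], hence no
    constant term. The higher differentials are linear. *)
Lemma minimal_free_resolution_lin_res (q : nat) (G : set R) (r : nat -> nat) :
  (0 < q)%N -> lin_res q (fun p => p \in ideal_gen G) r ->
  minimal_free_resolution (M := qmod G) (qgrading G) (cyclic_rank r).
Proof.
move=> q0 [e [D [eG De DD he hD]]].
pose C i : 'M[R]_(cyclic_rank r i.+1, cyclic_rank r i) :=
  if i is j.+1 then D j else e.
(* Linear syzygies place the whole basis of F_(j+1) in degree q + j. *)
pose sh i (_ : 'I_(cyclic_rank r i)) : int := if i is j.+1 then (q + j)%:Z else 0.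
have epsE (v : 'rV[R]_1) : \sum_k v 0 k *: qpi G 1 = qpi G (v 0 0).
  by rewrite big_ord1 -[_ *: _]/(qscale _ _) qscale_pi mulr1.
have hC i : homog_mx (if i is 0%N then q else 1%N) (C i).
  by case: i => [|i]; [exact: he|exact: hD].
exists sh, C, (fun=> qpi G 1); split.
- split=> [y|v|[|i] v]; last 2 first.
  + exact: De.
  + exact: DD.
  + by exists (repr y)%:M; rewrite epsE mxE eqxx mulr1n qpi_repr.
  rewrite [X in X = 0]epsE -(qpi0 G) qpiP subr0; split=> [/eG[w wP]|[w <-]].
    by exists w; rewrite [RHS]mx11_scalar -wP.
  by apply/eG; exists w; rewrite -mx11_scalar.
- split=> [k|i k l m /(dhomog_mf (hC i k l))/= ->].
    by exists 0%N; split=> //; exists 1 => //; exact: dhomog1.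
  by case: i k l => [|i] k l; rewrite /sh ?addn0 ?addr0// -PoszD addnCA.
- move=> i k l; apply: mcoeff0_irrelevant.
  apply: (dhomog_nemf_coeff (hC i k l)); rewrite /= mdeg0 eq_sym -lt0n.
  by case: (i).
Qed.

End HilbertFunction.

Theorem corollary2p2 (K : fieldType) (n : nat) (n_gt0 : (0 < n)%N)
    (I : {pred {mpoly K[n]}}) (I_mon : monomial_ideal I)
    (I_dim0 : krull_dim_quot I 0) :
  (forall i : nat, (1 <= i)%N ->
     betti (qmod (Lgens I)) (qgrading (Lgens I)) i =
       \big[addn/0%N]_(j \in [set: nat]) (hcomp I j * 'C(j, i.-1))%N) /\
  projdim (qmod (Lgens I)) = (nat_max [set mdeg u | u in Mon I]).+1.
Proof.
have [us [us_uniq usM]] := Mon_enum I_mon I_dim0.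
pose r i := \sum_(u <- us) 'C(mdeg u, i).
have res : minimal_free_resolution (M := qmod (Lgens I)) (qgrading (Lgens I))
    (cyclic_rank r).
  (* The generators of L(I) all have degree [n]. *)
  apply: (minimal_free_resolution_lin_res n_gt0).
  apply: lin_res_ext (lin_res_polar (b := bexp I) K us_uniq _ _) => //.
  - move=> p; rewrite (Lgens_polar I_mon I_dim0); apply: iff_trans (iff_sym _).
      2: exact: mon_ideal_gen.
    by apply: mon_ideal_ext => m; split=> -[u /usM uM ->]; exists u.
  - by move=> u /usM; exact: Mon_bounded.
  - by move=> u v /usM uM vu; apply/usM; exact: Mon_le uM vu.
split=> [[//|i] _|].
  by rewrite (betti_minimal _ res) (sum_hcomp _ I_mon us_uniq usM).
have [|u uus umax] := seq_max (@mdeg n) (s := us).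
  by apply/eqP => us0; have /usM := Mon0 I_dim0; rewrite us0.
rewrite (@nat_maxE _ (mdeg u)); last 2 first.
- by exists u => //; apply/usM.
- by move=> _ [v /usM vus <-]; exact: umax.
(* With d the largest degree, [u] contributes C(d, d) = 1 to the rank in degree d + 1, and beyond it
   every binomial vanishes. *)
apply: (projdim_minimal res) => [|[//|i]].
  by rewrite /= /r (big_rem u)//= binn.
rewrite ltnS => ui; rewrite /= /r big_seq big1// => v vus.
by rewrite bin_small// (leq_ltn_trans (umax v vus)).
Qed.
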